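(* Let $\mathfrak{B}$ be a bornology on a metric space $X$ with a closed base. Let the ideal $\mathcal{J}$ on $\omega$ have a pseudounion. The following statements are equivalent. (1) $X$ satisfies $\mathrm{S}_1(\Gamma_{\mathfrak{B}^s},\mathcal{J}\text{-}\Gamma_{\mathfrak{B}^s})$. (2) $X$ satisfies $\mathrm{S}_1(\Gamma_{\mathfrak{B}^s},\Gamma_{\mathfrak{B}^s})$.
   Context: $(X,d)$ is an infinite metric space; $\omega$ is the set of natural numbers. A bornology $\mathfrak{B}$ on $X$ is a family of subsets of $X$ that is closed under subsets and finite unions and covers $X$. A base of $\mathfrak{B}$ is a subfamily $\mathfrak{B}_0\subseteq\mathfrak{B}$ such that every $B\in\mathfrak{B}$ is contained in some $B_0\in\mathfrak{B}_0$; it is a closed base if its members are closed. For $B\in\mathfrak{B}$, $\delta>0$: $B^\delta=\bigcup_{x\in B}\{y\in X:d(x,y)<\delta\}$. An ideal on $\omega$ is a family $\mathcal{J}\subseteq\mathcal{P}(\omega)$ closed under subsets and finite unions, containing all finite sets, with $\omega\notin\mathcal{J}$. A set $A\subseteq\omega$ is a pseudounion of $\mathcal{J}$ if $\omega\setminus A$ is infinite and $I\setminus A$ is finite for every $I\in\mathcal{J}$. Covers of $X$ never contain $X$ as an element. An open cover $\{U_n:n\in\omega\}$ (with its enumeration) is a $\gamma_{\mathfrak{B}^s}$-cover if it is infinite and for each $B\in\mathfrak{B}$ there are $n_0\in\omega$ and positive reals $\delta_n$ ($n\geq n_0$) with $B^{\delta_n}\subseteq U_n$ for all $n\geq n_0$;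 $\Gamma_{\mathfrak{B}^s}$ is the class of these. A countable open cover $\{U_n:n\in\omega\}$ (with its enumeration) is a $\mathcal{J}$-$\gamma_{\mathfrak{B}^s}$-cover if for each $B\in\mathfrak{B}$ there is a sequence $\{\delta_n\}$ of positive reals with $\{n\in\omega:B^{\delta_n}\nsubseteq U_n\}\in\mathcal{J}$; $\mathcal{J}\text{-}\Gamma_{\mathfrak{B}^s}$ is the class of these. $\mathrm{S}_1(\mathcal{A},\mathcal{B})$: for every sequence $\{A_n:n\in\omega\}$ of elements of $\mathcal{A}$ there are $a_n\in A_n$ ($n\in\omega$) such that $\{a_n:n\in\omega\}\in\mathcal{B}$ (for enumerated covers, with the enumeration $n\mapsto a_n$). *)

(* Defs.v *)
From mathcomp Require Import all_boot all_order all_algebra.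
From mathcomp Require Import all_classical all_reals all_analysis.

Set Implicit Arguments.
Unset Strict Implicit.
Unset Printing Implicit Defensive.

Import Order.TTheory GRing.Theory Num.Theory.

Local Open Scope classical_set_scope.
Local Open Scope ring_scope.

Definition subset_closed {T : Type} (F : set (set T)) : Prop :=
  forall A B : set T, A `<=` B -> F B -> F A.

(* In [bornology] and [ideal] below, the empty (0-ary) union need not be
   required: set0 is in the family by the other clauses (T being nonempty). *)
Definition bornology {T : Type} (Bn : set (set T)) : Prop :=
  [/\ subset_closed Bn, setU_closed Bn & \bigcup_(B in Bn) B = [set: T]].

Definition base_of {T : Type} (Bn Bn0 : set (set T)) : Prop :=
  Bn0 `<=` Bn /\
  (forall B, Bn B -> exists2 B0, Bn0 B0 & B `<=` B0).

Definition has_closed_base {T : topologicalType} (Bn : set (set T)) : Prop :=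
  exists2 Bn0, base_of Bn Bn0 & (forall B, Bn0 B -> closed B).

Definition enlargement {R : realType} {X : metricType R}
    (B : set X) (delta : R) : set X :=
  \bigcup_(x in B) [set y | mdist x y < delta].

Definition ideal (J : set (set nat)) : Prop :=
  [/\ subset_closed J, setU_closed J,
      (forall A, finite_set A -> J A) & ~ J [set: nat]].

Definition pseudounion (J : set (set nat)) (A : set nat) : Prop :=
  infinite_set (~` A) /\ (forall I, J I -> finite_set (I `\` A)).

(* Covers are carried by their enumerations nat -> set X, which need not be
   injective; covers never have the whole space as a member. *)
Definition open_cover {T : topologicalType} (U : nat -> set T) : Prop :=
  [/\ (forall n, open (U n)), (forall n, U n <> [set: T])
    & \bigcup_n U n = [set: T]].

(* Infinitude is that of the family {U_n : n}, i.e. of the range of U. *)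
Definition Gamma_s {R : realType} {X : metricType R} (Bn : set (set X)) :
    set (nat -> set X) :=
  [set U | [/\ open_cover U, infinite_set (range U) &
    forall B, Bn B -> exists (n0 : nat) (delta : nat -> R),
      forall n, (n0 <= n)%N ->
        0 < delta n /\ enlargement B (delta n) `<=` U n]].

Definition J_Gamma_s {R : realType} {X : metricType R}
    (J : set (set nat)) (Bn : set (set X)) : set (nat -> set X) :=
  [set U | open_cover U /\
    forall B, Bn B -> exists delta : nat -> R,
      (forall n, 0 < delta n) /\
      J [set n | ~ (enlargement B (delta n) `<=` U n)]].

(* The selected member of the n-th cover is an element of the family, i.e. of
   the range of its enumeration. *)
Definition S1 {T : Type} (P Q : set (nat -> set T)) : Prop :=
  forall A : nat -> nat -> set T, (forall n, P (A n)) ->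
    exists a : nat -> set T, (forall n, range (A n) (a n)) /\ Q a.

(* Main.v *)
Require Import Defs.
From mathcomp Require Import all_boot all_order all_algebra.
From mathcomp Require Import all_classical all_reals all_analysis.

(** Every [Gamma_s] selection is a [J_Gamma_s] selection, because an ideal
    contains all finite sets of indices; this gives one implication.

    For the other one, let [A] be a pseudounion of [J].  An element of [J] meets
    the infinite set [~` A] in a finite set only, so the members of a
    [J_Gamma_s] cover whose indices lie outside [A] swallow an enlargement of
    each bounded set from some point on.  Enumerate infinitely many of these
    indices without repetition as [e 0], [e 1], and so on.  Given covers [U_0],
    [U_1], etc., run the selection principle on the rearranged sequence that has
    [U_i] at position [e i], and keep from the outcome only the sets chosen at
    the positions [e i]: the [i]-th one belongs to [U_i], and these sets have the
    eventual swallowing property ([J_Gamma_s_comp]).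

    It remains to see that the kept sets form an infinite open cover.  Both facts
    follow from the swallowing of finite sets, which are bounded
    ([Gamma_s_swallow]). *)

Local Open Scope classical_set_scope.

Lemma bornology_set1 {T : Type} {Bn : set (set T)} (x : T) :
  bornology Bn -> Bn [set x].
Proof.
case=> Bsub _ Bcov.
have [B BnB Bx] : (\bigcup_(B in Bn) B) x by rewrite Bcov.
by apply: Bsub BnB => _ ->.
Qed.

Lemma bornology_finite {T : choiceType} (Bn : set (set T)) (F : set T) :
  bornology Bn -> F !=set0 -> finite_set F -> Bn F.
Proof.
move=> hBn F0 /finite_seqP[s Fs]; have [Bsub BU _] := hBn.
(* A point [x0] of [F] is kept throughout, so that the induction starts from a
   singleton, which is bounded because [Bn] covers. *)
have [x0 _] := F0.
suff: Bn ([set x0] `|` F) by apply: Bsub => x; right.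
rewrite {F0}Fs {F}; elim: s => [|x s IHs].
  by apply: Bsub (bornology_set1 x0 hBn) => y [].
apply: Bsub (BU _ _ (bornology_set1 x hBn) IHs) => y /= [->|].
  by right; left.
by rewrite inE => /orP[/eqP ->|ys]; [left|right; right].
Qed.

Lemma finite_set_nat_bounded (D : set nat) :
  finite_set D -> exists n0, forall n, (n0 <= n)%N -> ~ D n.
Proof.
move=> /finite_seqP[s ->]; exists (\max_(i <- s) i).+1 => n + /= ns.
by rewrite ltnNge (@leq_bigmax_seq _ s xpredT id n).
Qed.

Lemma infinite_set_nat_injection {T : pointedType} {D : set T} :
  infinite_set D -> exists2 e : nat -> T, injective e & forall n, D (e n).
Proof.
rewrite finite_setPn => /contrapT/pcard_leP/injfunPex[e eD einj].
exists e => [i j eij|n]; last exact: eD.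
by apply: einj => //; rewrite inE.
Qed.

Lemma sub_enlargement {R : realType} {X : metricType R} (B : set X) (r : R) :
  (0 < r)%R -> B `<=` enlargement B r.
Proof. by move=> r0 x Bx; exists x => //=; rewrite mdistxx. Qed.

(** The sets cover since singletons are bounded.  If there were only finitely
    many of them, choosing a point outside each would give a finite, hence
    bounded, set contained in none of them. *)
Lemma Gamma_s_swallow {R : realType} {X : metricType R} (Bn : set (set X))
    (U : nat -> set X) :
  bornology Bn -> (forall n, open (U n)) -> (forall n, U n <> [set: X]) ->
  (forall B, Bn B -> exists (n0 : nat) (delta : nat -> R),
     forall n, (n0 <= n)%N ->
       (0 < delta n)%R /\ enlargement B (delta n) `<=` U n) ->
  Gamma_s Bn U.
Proof.
move=> hBn Uo UT swallow.
have subU B : Bn B -> exists n, B `<=` U n.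
  move=> /swallow[n0 [delta /(_ _ (leqnn n0))[d0 BU]]].
  by exists n0; apply: subset_trans BU; exact: sub_enlargement.
split => //.
- split => //; apply/seteqP; split => // x _.
  have [n xU] := subU _ (bornology_set1 x hBn).
  by exists n => //; exact: xU.
- move=> finU.
  have missed (V : set X) : exists x, V <> [set: X] -> ~ V x.
    have [->|VT] := pselect (V = [set: X]).
      have /existsNP[x _] : ~ forall x, U 0%N x.
        by move=> UxT; apply: (UT 0%N); apply/seteqP; split.
      by exists x.
    have /existsNP[x Vx] : ~ forall x, V x.
      by move=> VxT; apply: VT; apply/seteqP; split.
    by exists x.
  have {missed} [f fP] := choice missed.
  have BnF : Bn (f @` range U).
    apply: bornology_finite => //; last exact: finite_image.
    by exists (f (U 0%N)), (U 0%N) => //; exists 0%N.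
  have [n FU] := subU _ BnF.
  by apply: (fP _ (UT n)); apply: FU; exists (U n) => //; exists n.
Qed.

Lemma Gamma_s_J_Gamma_s {R : realType} {X : metricType R}
    (J : set (set nat)) (Bn : set (set X)) :
  (forall D, finite_set D -> J D) -> Gamma_s Bn `<=` J_Gamma_s J Bn.
Proof.
move=> Jfin U [Ucov _ swallow]; split=> // B /swallow[n0 [delta dP]].
exists (fun n => if (n0 <= n)%N then delta n else 1%R); split.
  by move=> n; case: ifPn => // /dP[].
apply: Jfin; apply: sub_finite_set (finite_II n0) => n /=.
by case: ifPn => [/dP[]|]; rewrite // -ltnNge.
Qed.

(** For each bounded set the bad indices outside [A] are finitely many, and an
    injection takes finitely many values [i] to them. *)
Lemma J_Gamma_s_comp {R : realType} {X : metricType R}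
    (J : set (set nat)) (A : set nat) (Bn : set (set X))
    (U : nat -> set X) (e : nat -> nat) :
  bornology Bn -> (forall I, J I -> finite_set (I `\` A)) ->
  injective e -> (forall i, ~ A (e i)) ->
  J_Gamma_s J Bn U -> Gamma_s Bn (U \o e).
Proof.
move=> hBn JA einj eA [[Uo UT _] JU].
apply: Gamma_s_swallow => [//|n|n|B BnB]; [exact: Uo|exact: UT|].
have [delta [d0 JB]] := JU B BnB.
have /finite_set_nat_bounded[n0 n0P] :
    finite_set (e @^-1` ([set n | ~ (enlargement B (delta n) `<=` U n)] `\` A)).
  by apply: finite_preimage (JA _ JB) => i j _ _; exact: einj.
exists n0, (delta \o e) => n /n0P nbad; split; first exact: d0.
by apply: contrapT => BU; apply: nbad; split.
Qed.

Theorem theorem3p14 (R : realType) (X : metricType R)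
    (Xinf : infinite_set [set: X])
    (Bn : set (set X)) (hBn : bornology Bn) (hbase : has_closed_base Bn)
    (J : set (set nat)) (hJ : ideal J)
    (hpu : exists A : set nat, pseudounion J A) :
  S1 (Gamma_s Bn) (J_Gamma_s J Bn) <-> S1 (Gamma_s Bn) (Gamma_s Bn).
Proof.
split=> [S1J U UP|S1G U UP].
  have [A [Ainf JA]] := hpu.
  have [e einj eA] := infinite_set_nat_injection Ainf.
  (* [g] sends the position [e i] back to [i]; its values elsewhere only pad the
     rearranged sequence. *)
  pose g := 'pinv_(fun=> 0%N) [set: nat] e.
  have eK : cancel e g.
    by move=> i; apply: pinvKV; rewrite ?inE // => j k _ _; exact: einj.
  have [a [aU aJ]] := S1J (U \o g) (fun n => UP (g n)).
  exists (a \o e); split=> [i|]; last exact: (J_Gamma_s_comp J A).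
  by have := aU (e i); rewrite /= eK.
have [a [aU aG]] := S1G U UP.
by exists a; split=> //; apply: Gamma_s_J_Gamma_s aG; case: hJ.
Qed.
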